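(* Let $\lambda\in\mathbb C^\times$, $\overline\alpha=(\alpha_0,\alpha_1,\dots,\alpha_{p-1})\in\mathbb C^p$, and let $M$ be an irreducible restricted $\mathfrak g$-module. (1) If $\overline\alpha\neq\overline0$, then the $\mathfrak g$-module $\Omega(\lambda,\overline\alpha)\otimes M$ is irreducible. (2) The $\mathfrak g$-module $t\,\Omega(\lambda,\overline0)\otimes M$ is irreducible.
   Context: All vector spaces and algebras are over $\mathbb C$; $\mathbb C^\times=\mathbb C\setminus\{0\}$; $p>1$ is a fixed integer; $\overline0=(0,\dots,0)\in\mathbb C^p$. Gap-$p$ Virasoro algebra. $\mathfrak g$ is the Lie algebra with basis $\{L_n, I_n^{(i)}, C_j : n\in\mathbb Z, 1\le i\le p-1, 0\le j\le \lfloor p/2\rfloor\}$ and brackets $[L_m,L_n]=(m-n)L_{m+n}+\frac1{12}(m^3-m)\delta_{m+n,0}C_0$, $[I_m^{(i)},I_n^{(j)}]=(m+\frac ip)\delta_{i+j,p}\delta_{m+n+1,0}C_i$, $[L_m,I_n^{(i)}]=-(n+\frac ip)I_{m+n}^{(i)}$, all $C_k$ central; one sets $C_i:=C_{p-i}$ for $\lfloor p/2\rfloor<i\le p-1$. A $\mathfrak g$-module $M$ is restricted if for each $v\in M$ there is $N\in\mathbb N$ with $L_nv=I_n^{(i)}v=0$ for all $n\ge N$ (with $n\geq 1$) and $1\le i\le p-1$ (i.e. restricted for the $\mathbb Z$-grading with $L_n,I_n^{(i)}$ in degree $n$ and all $C_j$ in degree $0$). For $\lambda\in\mathbb C^\times$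 and $\overline\alpha\in\mathbb C^p$, $\Omega(\lambda,\overline\alpha)$ denotes the $\mathfrak g$-module on $\mathbb C[t]$ with $L_nf(t)=\lambda^n(t+\alpha_0n)f(t+n)$, $I_n^{(i)}f(t)=\alpha_i\lambda^nf(t+n+\frac ip)$, $C_jf(t)=0$ for $n\in\mathbb Z$, $1\le i\le p-1$, $0\le j\le p-1$. $t\,\Omega(\lambda,\overline0)=t\,\mathbb C[t]$ is a $\mathfrak g$-submodule of $\Omega(\lambda,\overline0)$. *)

(* Defs.v *)
From HB Require Import structures.
From mathcomp Require Import all_boot all_order all_algebra.
From mathcomp Require Import boolp classical_sets reals.
From mathcomp Require Import complex.
From mathcomp Require Import finmap monalg.
From mathcomp Require Import ring zify.

Set Implicit Arguments.
Unset Strict Implicit.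
Unset Printing Implicit Defensive.

Import GRing.Theory Num.Theory.

Local Open Scope ring_scope.
Local Open Scope quotient_scope.
Local Open Scope classical_set_scope.

(* [{malg K[T]}] is used throughout as the free [K]-module on the set [T].   *)
(* The constants are locked because unfolding them in unification is costly. *)
HB.lock Definition bvec (K : fieldType) (T : choiceType) (k : T) :
  {malg K[T]} := << k >>.

HB.lock Definition linext (K : fieldType) (T : choiceType) (U : lmodType K)
    (f : T -> U) (x : {malg K[T]}) : U :=
  \sum_(k <- msupp x) x@_k *: f k.

Section FreeModule.
Variables (K : fieldType) (T : choiceType) (U : lmodType K).

Lemma linextEw (f : T -> U) (d : {fset T}) (x : {malg K[T]}) :
  (msupp x `<=` d)%fset -> linext f x = \sum_(k <- d) x@_k *: f k.
Proof.
move=> le_xd; rewrite linext.unlock (big_fset_incl _ le_xd) //= => k _ kNx.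
by rewrite mcoeff_outdom ?scale0r.
Qed.

Lemma linext_linear (f : T -> U) : linear (linext f).
Proof.
move=> a x y.
pose d := (msupp x `|` msupp y `|` msupp (a *: x + y))%fset.
rewrite !(@linextEw f d) ?scaler_sumr -?big_split /=; last first.
- by apply/fsubsetP=> k; rewrite !inE => ->; rewrite ?orbT.
- by apply/fsubsetP=> k; rewrite !inE => ->; rewrite ?orbT.
- by apply/fsubsetP=> k; rewrite !inE => ->; rewrite ?orbT.
by apply: eq_bigr => k _; rewrite mcoeffD mcoeffZ scalerDl scalerA.
Qed.

HB.instance Definition _ (f : T -> U) :=
  GRing.isLinear.Build K {malg K[T]} U _ (linext f) (linext_linear f).

Lemma linextU (f : T -> U) (k : T) : linext f (bvec K k) = f k.
Proof.
by rewrite linext.unlock bvec.unlock msuppU oner_eq0 big_seq_fset1 mcoeffUU scale1r.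
Qed.

Lemma free_ind (P : {malg K[T]} -> Prop) :
  P 0 -> (forall a x y, P x -> P y -> P (a *: x + y)) ->
  (forall k, P (bvec K k)) -> forall x, P x.
Proof.
move=> P0 PD PU x; rewrite (monalgE x).
elim: (finmap.enum_fset _) => [|k s IHs]; first by rewrite big_nil.
rewrite big_cons; have -> : << x@_k *g k >> = x@_k *: bvec K k.
  by rewrite bvec.unlock; apply/malgP=> j; rewrite mcoeffZ !mcoeffU mulrnAr mulr1.
exact: PD.
Qed.

Definition linext2 (f : T -> T -> U) (x y : {malg K[T]}) : U :=
  linext (fun a => linext (f a) y) x.

Lemma linext2_linearl f y a x1 x2 :
  linext2 f (a *: x1 + x2) y = a *: linext2 f x1 y + linext2 f x2 y.
Proof. exact: linext_linear. Qed.

Lemma linext2_linearr f x a y1 y2 :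
  linext2 f x (a *: y1 + y2) = a *: linext2 f x y1 + linext2 f x y2.
Proof.
rewrite /linext2; elim/free_ind: x => [|b x1 x2 h1 h2|k].
- by rewrite !linear0 addr0.
- by rewrite !linext_linear h1 h2 !scalerDr !scalerA (mulrC b) addrACA.
- by rewrite !linextU linext_linear.
Qed.

Lemma linext2U f a b : linext2 f (bvec K a) (bvec K b) = f a b.
Proof. by rewrite /linext2 !linextU. Qed.

End FreeModule.

HB.mixin Record Lmodule_isLie (K : fieldType) (g : Type) of GRing.Lmodule K g := {
  lie : g -> g -> g;
  lie_linearl : forall y a (x1 x2 : g),
    lie (a *: x1 + x2) y = a *: lie x1 y + lie x2 y;
  lie_linearr : forall x a (y1 y2 : g),
    lie x (a *: y1 + y2) = a *: lie x y1 + lie x y2;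
  liexx : forall x, lie x x = 0;
  lie_jacobi : forall x y z,
    lie x (lie y z) + lie y (lie z x) + lie z (lie x y) = 0
}.

#[short(type="lieAlgType")]
HB.structure Definition Lie (K : fieldType) :=
  { g of GRing.Lmodule K g & Lmodule_isLie K g }.

Record lieModule (K : fieldType) (g : lieAlgType K) := LieModule {
  lmod_sort :> lmodType K;
  act : g -> lmod_sort -> lmod_sort;
  act_linearl : forall v a x y, act (a *: x + y) v = a *: act x v + act y v;
  act_linearr : forall x a v w, act x (a *: v + w) = a *: act x v + act x w;
  act_lie : forall x y v, act (lie x y) v = act x (act y v) - act y (act x v)
}.

Section LieModules.
Variables (K : fieldType) (g : lieAlgType K).

Definition is_submodule (M : lieModule g) (N : set M) : Prop :=
  [/\ N 0,
      forall a v w, N v -> N w -> N (a *: v + w)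
    & forall x v, N v -> N (act x v)].

Definition irreducible (M : lieModule g) : Prop :=
  (exists v : M, v != 0) /\
  forall N : set M, is_submodule N -> N = [set 0] \/ N = setT.

Section Submodule.
Variables (M : lieModule g) (N : set M) (hN : is_submodule N).

Definition subm_pred of is_submodule N : {pred M} := fun v => `[< N v >].

Lemma subm_pred_closed : submod_closed (subm_pred hN).
Proof.
have [N0 ND _] := hN; split; first exact/asboolP.
by move=> a v w /asboolP Nv /asboolP Nw; apply/asboolP/ND.
Qed.

HB.instance Definition _ :=
  GRing.isSubmodClosed.Build K M (subm_pred hN) subm_pred_closed.

Definition subm_type : Type := {v : M | v \in subm_pred hN}.

HB.instance Definition _ := SubChoice.on subm_type.
HB.instance Definition _ := [SubChoice_isSubLmodule of subm_type by <:].

Lemma subm_act_closed x (v : subm_type) : act x (val v) \in subm_pred hN.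
Proof. by have [_ _ NA] := hN; apply/asboolP/NA/asboolP/(valP v). Qed.

Definition subm_act (x : g) (v : subm_type) : subm_type :=
  Sub (act x (val v)) (subm_act_closed x v).

Fact subm_act_linearl v a x y :
  subm_act (a *: x + y) v = a *: subm_act x v + subm_act y v.
Proof. by apply: val_inj; exact: act_linearl. Qed.

Fact subm_act_linearr x a v w :
  subm_act x (a *: v + w) = a *: subm_act x v + subm_act x w.
Proof. by apply: val_inj; exact: act_linearr. Qed.

Fact subm_act_lie x y v :
  subm_act (lie x y) v = subm_act x (subm_act y v) - subm_act y (subm_act x v).
Proof. by apply: val_inj; exact: act_lie. Qed.

Definition submodule : lieModule g :=
  LieModule subm_act_linearl subm_act_linearr subm_act_lie.

End Submodule.
End LieModules.

(* The tensor product of two (possibly infinite-dimensional) vector spaces: *)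
(* the free vector space on [V * W] modulo the bilinearity relations.       *)
Section Tensor.
Variables (K : fieldType) (V W : lmodType K).

Let F := {malg K[(V * W)%type]}.

Definition bilin_rel : set F :=
  [set x | (exists a v1 v2 w,
              x = bvec K (a *: v1 + v2, w) - (a *: bvec K (v1, w) + bvec K (v2, w)))
        \/ (exists a v w1 w2,
              x = bvec K (v, a *: w1 + w2) - (a *: bvec K (v, w1) + bvec K (v, w2)))].

Definition is_subspace (S : set F) : Prop :=
  S 0 /\ forall a x y, S x -> S y -> S (a *: x + y).

Definition bilin_span : set F :=
  [set x | forall S, is_subspace S -> bilin_rel `<=` S -> S x].

Lemma bilin_span_subspace : is_subspace bilin_span.
Proof.
split=> [S [S0 _] _ //|a x y hx hy S hS hb].
by case: (hS) => _ SD; apply: SD; [apply: hx | apply: hy].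
Qed.

Lemma bilin_rel_span : bilin_rel `<=` bilin_span.
Proof. by move=> x hx S _; apply. Qed.

Let span0 : bilin_span 0. Proof. by case: bilin_span_subspace. Qed.
Let spanP a x y : bilin_span x -> bilin_span y -> bilin_span (a *: x + y).
Proof. by case: bilin_span_subspace => _; apply. Qed.
Let spanD x y : bilin_span x -> bilin_span y -> bilin_span (x + y).
Proof. by move=> hx hy; rewrite -[x]scale1r; apply: spanP. Qed.
Let spanZ a x : bilin_span x -> bilin_span (a *: x).
Proof. by move=> hx; rewrite -[_ *: _]addr0; apply: spanP. Qed.

Definition tensor_eq : rel F := fun x y => `[< bilin_span (x - y) >].

Lemma tensor_eq_refl : reflexive tensor_eq.
Proof. by move=> x; apply/asboolP; rewrite subrr. Qed.

Lemma tensor_eq_sym : symmetric tensor_eq.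
Proof.
move=> x y; apply/asboolP/asboolP=> h; rewrite -opprB -scaleN1r;
by apply: spanZ.
Qed.

Lemma tensor_eq_trans : transitive tensor_eq.
Proof.
move=> y x z /asboolP hxy /asboolP hyz; apply/asboolP.
by rewrite -(subrKA y); apply: spanD.
Qed.

Canonical tensor_equiv : equiv_rel F :=
  EquivRel tensor_eq tensor_eq_refl tensor_eq_sym tensor_eq_trans.

Definition tensor : Type := {eq_quot tensor_eq}.

HB.instance Definition _ : EqQuotient F tensor_eq tensor := EqQuotient.on tensor.
HB.instance Definition _ := Choice.on tensor.

Lemma tensor_eqP (x y : F) :
  reflect (\pi_tensor x = \pi_tensor y) `[< bilin_span (x - y) >].
Proof. by apply: (iffP idP) => [h|/eqmodP//]; apply/eqmodP. Qed.

Lemma tensorW (P : tensor -> Prop) :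
  (forall x, P (\pi_tensor x)) -> forall x, P x.
Proof. by move=> h x; rewrite -[x]reprK; apply: h. Qed.

Lemma tensor_reprP (x : F) : bilin_span (repr (\pi_tensor x) - x).
Proof. by apply/asboolP/tensor_eqP; rewrite reprK. Qed.

(* Locked: unfolding these during unification is very costly. *)
Fact tensor_key : unit. Proof. by []. Qed.
Definition tensor_add : tensor -> tensor -> tensor :=
  locked_with tensor_key (fun x y => \pi_tensor (repr x + repr y)).
Definition tensor_opp : tensor -> tensor :=
  locked_with tensor_key (fun x => \pi_tensor (- repr x)).
Definition tensor_scale : K -> tensor -> tensor :=
  locked_with tensor_key (fun a x => \pi_tensor (a *: repr x)).

Lemma tensor_addE x y :
  tensor_add (\pi_tensor x) (\pi_tensor y) = \pi_tensor (x + y).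
Proof.
rewrite /tensor_add unlock; apply/tensor_eqP/asboolP.
rewrite opprD addrACA; apply: spanD; exact: tensor_reprP.
Qed.

Lemma tensor_oppE x : tensor_opp (\pi_tensor x) = \pi_tensor (- x).
Proof.
rewrite /tensor_opp unlock; apply/tensor_eqP/asboolP; rewrite -opprD -scaleN1r.
apply: spanZ; exact: tensor_reprP.
Qed.

Lemma tensor_scaleE a x : tensor_scale a (\pi_tensor x) = \pi_tensor (a *: x).
Proof.
rewrite /tensor_scale unlock; apply/tensor_eqP/asboolP; rewrite -scalerBr.
apply: spanZ; exact: tensor_reprP.
Qed.

Fact tensor_addA : associative tensor_add.
Proof.
elim/tensorW=> x; elim/tensorW=> y; elim/tensorW=> z.
by rewrite !tensor_addE addrA.
Qed.
Fact tensor_addC : commutative tensor_add.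
Proof. by elim/tensorW=> x; elim/tensorW=> y; rewrite !tensor_addE addrC. Qed.
Fact tensor_add0 : left_id (\pi_tensor 0) tensor_add.
Proof. by elim/tensorW=> x; rewrite tensor_addE add0r. Qed.
Fact tensor_addN : left_inverse (\pi_tensor 0) tensor_opp tensor_add.
Proof. by elim/tensorW=> x; rewrite tensor_oppE tensor_addE addNr. Qed.

HB.instance Definition _ := GRing.isZmodule.Build tensor
  tensor_addA tensor_addC tensor_add0 tensor_addN.

Lemma tpiD x y : \pi_tensor (x + y) = \pi_tensor x + \pi_tensor y.
Proof. by rewrite -tensor_addE. Qed.

Fact tensor_scaleA a b x :
  tensor_scale a (tensor_scale b x) = tensor_scale (a * b) x.
Proof. by elim/tensorW: x => x; rewrite !tensor_scaleE scalerA. Qed.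
Fact tensor_scale1 : left_id 1 tensor_scale.
Proof. by elim/tensorW=> x; rewrite tensor_scaleE scale1r. Qed.
Fact tensor_scaleDr : right_distributive tensor_scale +%R.
Proof.
move=> a; elim/tensorW=> x; elim/tensorW=> y.
by rewrite -tpiD !tensor_scaleE -tpiD scalerDr.
Qed.
Fact tensor_scaleDl x : {morph tensor_scale^~ x : a b / a + b}.
Proof. by elim/tensorW: x => x a b; rewrite !tensor_scaleE -tpiD scalerDl. Qed.

HB.instance Definition _ := GRing.Zmodule_isLmodule.Build K tensor
  tensor_scaleA tensor_scale1 tensor_scaleDr tensor_scaleDl.

Lemma tpi_linear : linear (\pi_tensor : F -> tensor).
Proof. by move=> a x y; rewrite tpiD -tensor_scaleE. Qed.

Definition tens (v : V) (w : W) : tensor := \pi_tensor (bvec K (v, w)).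

Lemma tens_linearl w a v1 v2 :
  tens (a *: v1 + v2) w = a *: tens v1 w + tens v2 w.
Proof.
rewrite /tens -tpi_linear; apply/tensor_eqP/asboolP; apply: bilin_rel_span.
by left; exists a, v1, v2, w.
Qed.

Lemma tens_linearr v a w1 w2 :
  tens v (a *: w1 + w2) = a *: tens v w1 + tens v w2.
Proof.
rewrite /tens -tpi_linear; apply/tensor_eqP/asboolP; apply: bilin_rel_span.
by right; exists a, v, w1, w2.
Qed.

Lemma tensor_ind (P : tensor -> Prop) :
  P 0 -> (forall a x y, P x -> P y -> P (a *: x + y)) ->
  (forall v w, P (tens v w)) -> forall x, P x.
Proof.
move=> P0 PD Pt; elim/tensorW; apply: free_ind => //.
- by move=> a x y hx hy; rewrite tpi_linear; apply: PD.
- by case.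
Qed.

Section Lift.
Variables (U : lmodType K) (f : V -> W -> U).
Hypothesis flinl : forall w a v1 v2, f (a *: v1 + v2) w = a *: f v1 w + f v2 w.
Hypothesis flinr : forall v a w1 w2, f v (a *: w1 + w2) = a *: f v w1 + f v w2.

Definition tlift (x : tensor) : U := linext (fun vw => f vw.1 vw.2) (repr x).

Lemma tlift_pi x : tlift (\pi_tensor x) = linext (fun vw => f vw.1 vw.2) x.
Proof.
apply/eqP; rewrite -subr_eq0 -linearB /=; apply/eqP.
apply: (tensor_reprP x (S := [set y | linext _ y = 0])).
  split=> [|a y z /= hy hz]; first exact: linear0.
  by rewrite linext_linear hy hz scaler0 addr0.
move=> _ [[a [v1 [v2 [w ->]]]]|[a [v [w1 [w2 ->]]]]] /=.
  by rewrite linearB /= linext_linear !linextU /= flinl subrr.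
by rewrite linearB /= linext_linear !linextU /= flinr subrr.
Qed.

Lemma tlift_tens v w : tlift (tens v w) = f v w.
Proof. by rewrite tlift_pi linextU. Qed.

Lemma tlift_linear : linear tlift.
Proof.
move=> a; elim/tensorW=> x; elim/tensorW=> y.
by rewrite -tpi_linear !tlift_pi linext_linear.
Qed.

End Lift.
End Tensor.

Section TensorModule.
Variables (K : fieldType) (g : lieAlgType K) (M N : lieModule g).

Definition tens_gen (x : g) (v : M) (w : N) : tensor M N :=
  tens (act x v) w + tens v (act x w).

Definition tens_act (x : g) : tensor M N -> tensor M N := tlift (tens_gen x).

Let genl x w a v1 v2 :
  tens_gen x (a *: v1 + v2) w = a *: tens_gen x v1 w + tens_gen x v2 w.
Proof. by rewrite /tens_gen act_linearr !tens_linearl scalerDr addrACA. Qed.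

Let genr x v a w1 w2 :
  tens_gen x v (a *: w1 + w2) = a *: tens_gen x v w1 + tens_gen x v w2.
Proof. by rewrite /tens_gen act_linearr !tens_linearr scalerDr addrACA. Qed.

Lemma tens_actE x v w :
  tens_act x (tens v w) = tens (act x v) w + tens v (act x w).
Proof. exact: (tlift_tens (genl x) (genr x)). Qed.

Fact tens_act_linearr x a v w :
  tens_act x (a *: v + w) = a *: tens_act x v + tens_act x w.
Proof. exact: (tlift_linear (genl x) (genr x)). Qed.

Let act0 x : tens_act x 0 = 0.
Proof.
have := tens_act_linearr x (-1) 0 0.
by rewrite !scaleN1r oppr0 addr0 addNr.
Qed.

Let actD x v w : tens_act x (v + w) = tens_act x v + tens_act x w.
Proof. by rewrite -[v]scale1r tens_act_linearr !scale1r. Qed.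

Let tensBl (v1 v2 : M) (w : N) : tens (v1 - v2) w = tens v1 w - tens v2 w.
Proof. by rewrite addrC -scaleN1r tens_linearl scaleN1r addrC. Qed.

Let tensBr (v : M) (w1 w2 : N) : tens v (w1 - w2) = tens v w1 - tens v w2.
Proof. by rewrite addrC -scaleN1r tens_linearr scaleN1r addrC. Qed.

Let abel (Z : zmodType) (a b c d e f : Z) :
  a - b + (c - d) = a + e + (f + c) - (b + f + (e + d)).
Proof.
rewrite !opprD !addrA [RHS](ACl (1*5*4*8*(2*7)*(3*6)))%AC /=.
by rewrite !subrr !addr0.
Qed.

Fact tens_act_linearl v a x y :
  tens_act (a *: x + y) v = a *: tens_act x v + tens_act y v.
Proof.
elim/tensor_ind: v => [|b v w hv hw|v w].
- by rewrite !act0 scaler0 addr0.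
- rewrite !tens_act_linearr hv hw !scalerDr !scalerA (mulrC a b).
  by rewrite addrACA.
- rewrite !tens_actE !act_linearl tens_linearl tens_linearr scalerDr.
  by rewrite addrACA.
Qed.

Fact tens_act_lie x y v :
  tens_act (lie x y) v = tens_act x (tens_act y v) - tens_act y (tens_act x v).
Proof.
elim/tensor_ind: v => [|b v w hv hw|v w].
- by rewrite !act0 subr0.
- rewrite !tens_act_linearr hv hw scalerBr opprD.
  by rewrite addrACA.
- by rewrite !tens_actE !actD !tens_actE !act_lie tensBl tensBr; exact: abel.
Qed.

Definition tensor_module : lieModule g :=
  LieModule tens_act_linearl tens_act_linearr tens_act_lie.

End TensorModule.

(* The superscripts [i] with [1 <= i <= p - 1] of the generators [I_n^(i)]. *)
Definition supidx (p : nat) : Type := {i : 'I_p | (0 < i)%N}.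
HB.instance Definition _ p := SubChoice.on (supidx p).
Definition nat_of_supidx p (i : supidx p) : nat := val (val i).
Coercion nat_of_supidx : supidx >-> nat.

Inductive gapgen (p : nat) :=
  | GL of int
  | GI of int & supidx p
  | GC of 'I_(p./2).+1.
Arguments GC p _ : clear implicits.

Section GapGenChoice.
Variable p : nat.
Definition gapgen_code (x : gapgen p) : int + int * supidx p + 'I_(p./2).+1 :=
  match x with
  | GL m => inl (inl m)
  | GI m i => inl (inr (m, i))
  | GC j => inr j
  end.
Definition gapgen_decode (x : int + int * supidx p + 'I_(p./2).+1) : gapgen p :=
  match x with
  | inl (inl m) => GL p m
  | inl (inr (m, i)) => GI m i
  | inr j => GC p j
  end.
Lemma gapgen_codeK : cancel gapgen_code gapgen_decode.
Proof. by case. Qed.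
HB.instance Definition _ := Choice.copy (gapgen p) (can_type gapgen_codeK).
End GapGenChoice.

(* The identities are proved over an abstract [V]: unification in the concrete *)
(* [{malg K[gapgen p]}] is too slow.                                          *)
Section GapRelations.
Variables (K : numFieldType) (p : nat) (V : lmodType K) (br : V -> V -> V).
Variables (L : int -> V) (I : int -> supidx p -> V) (C : nat -> V).

Let shift (n : int) (i : nat) : K := n%:~R + i%:R / p%:R.

Hypothesis ind : forall P : V -> Prop,
  P 0 -> (forall a x y, P x -> P y -> P (a *: x + y)) ->
  (forall m, P (L m)) -> (forall m i, P (I m i)) -> (forall k, P (C k)) ->
  forall x, P x.
Hypothesis linl : forall y a x1 x2, br (a *: x1 + x2) y = a *: br x1 y + br x2 y.
Hypothesis linr : forall x a y1 y2, br x (a *: y1 + y2) = a *: br x y1 + br x y2.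
Hypothesis brLL : forall m n, br (L m) (L n) =
  (m - n)%:~R *: L (m + n)
  + ((m ^+ 3 - m)%:~R / 12%:R * (m + n == 0)%:R) *: C 0.
Hypothesis brLI : forall m n i, br (L m) (I n i) = - shift n i *: I (m + n) i.
Hypothesis brIL : forall m n i, br (I n i) (L m) = shift n i *: I (m + n) i.
Hypothesis brII : forall m n i j, br (I m i) (I n j) =
  (shift m i * ((i + j == p)%N && (m + n + 1 == 0))%:R) *: C i.
Hypothesis brCr : forall x k, br x (C k) = 0.
Hypothesis brCl : forall k x, br (C k) x = 0.
Hypothesis C_sym : forall i j, (i + j)%N = p -> C i = C j.

Let brDl y x1 x2 : br (x1 + x2) y = br x1 y + br x2 y.
Proof. by rewrite -[x1]scale1r linl !scale1r. Qed.

Let brDr x y1 y2 : br x (y1 + y2) = br x y1 + br x y2.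
Proof. by rewrite -[y1]scale1r linr !scale1r. Qed.

Let br0l y : br 0 y = 0.
Proof. by apply: (addrI (br 0 y)); rewrite -brDl !addr0. Qed.

Let br0r x : br x 0 = 0.
Proof. by apply: (addrI (br x 0)); rewrite -brDr !addr0. Qed.

Let brZl a x y : br (a *: x) y = a *: br x y.
Proof. by rewrite -[a *: x]addr0 linl br0l addr0. Qed.

Let brZr a x y : br x (a *: y) = a *: br x y.
Proof. by rewrite -[a *: y]addr0 linr br0r addr0. Qed.

Let shift_opp m n (i j : supidx p) :
  (i + j)%N = p -> m + n + 1 = 0 -> shift n j = - shift m i.
Proof.
move=> e h; have hp : p%:R != 0 :> K.
  by rewrite pnatr_eq0 -lt0n (leq_ltn_trans _ (ltn_ord (val i))).
have -> : n = - m - 1 by lia.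
have ep : p%:R = i%:R + j%:R :> K by rewrite -natrD e.
have ej : j%:R = p%:R - i%:R :> K by rewrite ep addrC addKr.
by rewrite /shift ej intrB intrN; field.
Qed.

Lemma br_anti x y : br y x = - br x y.
Proof.
elim/ind: x y => [y|a x1 x2 h1 h2 y|m y|m i y|k y].
- by rewrite br0l br0r oppr0.
- by rewrite linl linr h1 h2 scalerN opprD.
- elim/ind: y => [|a x1 x2 h1 h2|n|n i|k].
  + by rewrite br0l br0r oppr0.
  + by rewrite linl linr h1 h2 scalerN opprD.
  + rewrite !brLL opprD (addrC n m) -!scaleNr -intrN opprB; congr (_ + _ *: _).
    case: eqP => [e|_]; last by rewrite !mulr0 oppr0.
    have -> : n = - m by lia.
    by rewrite !mulr1 !(intrB, rmorphXn, intrN) /=; ring.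
  + by rewrite brLI brIL scaleNr opprK.
  + by rewrite brCl brCr oppr0.
- elim/ind: y => [|a x1 x2 h1 h2|n|n j|k].
  + by rewrite br0l br0r oppr0.
  + by rewrite linl linr h1 h2 scalerN opprD.
  + by rewrite brLI brIL scaleNr.
  + rewrite !brII -scaleNr (addnC j) (addrC n).
    case: eqP => [e|_]; last by rewrite !mulr0 oppr0 !scale0r.
    case: eqP => [h|_]; last by rewrite !mulr0 oppr0 !scale0r.
    by rewrite !mulr1 (C_sym e) (shift_opp e h).
  + by rewrite brCl brCr oppr0.
- by rewrite brCl brCr oppr0.
Qed.

Lemma br_alt x : br x x = 0.
Proof.
have /eqP := br_anti x x.
rewrite -addr_eq0 -mulr2n -scaler_nat scaler_eq0 pnatr_eq0 /=.
by move/eqP.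
Qed.

Let J x y z := br x (br y z) + br y (br z x) + br z (br x y).

Let Jrot x y z : J x y z = J y z x.
Proof. by rewrite /J -addrA addrC. Qed.

Let J0 y z : J 0 y z = 0.
Proof. by rewrite /J !(br0l, br0r) !addr0. Qed.

Let JP y z a x1 x2 : J x1 y z = 0 -> J x2 y z = 0 -> J (a *: x1 + x2) y z = 0.
Proof.
move=> h1 h2; have -> : J (a *: x1 + x2) y z = a *: J x1 y z + J x2 y z.
  by rewrite /J !(linl, linr) !scalerDr (addrACA (a *: _)) (addrACA (_ + _)).
by rewrite h1 h2 scaler0 addr0.
Qed.

Let JC k y z : J (C k) y z = 0.
Proof. by rewrite /J !(brCl, brCr, br0r) !addr0. Qed.

Let JLLL m n l : J (L m) (L n) (L l) = 0.
Proof.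
rewrite /J !brLL !(brDr, brZr) !brLL !brCr !scaler0 !addr0 !scalerDr !scalerA.
rewrite (_ : n + (l + m) = m + (n + l)); last by ring.
rewrite (_ : l + (m + n) = m + (n + l)); last by ring.
rewrite (addrACA (_ *: _)) (addrACA (_ + _)) -!scalerDl -[RHS]addr0.
congr (_ + _); apply/eqP; rewrite scaler_eq0; apply/orP; left; apply/eqP.
  by rewrite !(intrB, intrD); ring.
case: eqP => [e|_]; last by rewrite !mulr0 !addr0.
have -> : m = - (n + l) by lia.
by rewrite !mulr1 !(intrB, rmorphXn, intrN, intrD) /=; ring.
Qed.

Let JLLI m n l i : J (L m) (L n) (I l i) = 0.
Proof.
rewrite /J brLI brIL brLL !(brDr, brZr) brCr !brLI !brIL scaler0 addr0 !scalerA.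
rewrite (_ : n + (m + l) = m + (n + l)); last by ring.
rewrite (_ : m + n + l = m + (n + l)); last by ring.
rewrite -!scalerDl; apply/eqP; rewrite scaler_eq0; apply/orP; left; apply/eqP.
by rewrite /shift !intrD intrN; ring.
Qed.

Let JLII m n l i j : J (L m) (I n i) (I l j) = 0.
Proof.
rewrite /J brII brIL brLI !brZr brCr !brII scaler0 add0r !scalerA.
rewrite (addnC j) (_ : l + (m + n) + 1 = n + (m + l) + 1); last by ring.
case: eqP => [e|_]; last by rewrite !mulr0 !scale0r addr0.
rewrite (C_sym e) -scalerDl.
case: eqP => [h|_]; last by rewrite !mulr0 addr0 scale0r.
by rewrite !mulr1 mulNr (mulrC (shift n i)) subrr scale0r.
Qed.

Let JIII m n l i j k : J (I m i) (I n j) (I l k) = 0.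
Proof. by rewrite /J !brII !brZr !brCr !scaler0 !addr0. Qed.

Lemma br_jacobi x y z : br x (br y z) + br y (br z x) + br z (br x y) = 0.
Proof.
rewrite -/(J x y z).
elim/ind: x => [|a x1 x2|m|m i|k]; [exact: J0 | exact: JP | | | exact: JC];
  rewrite Jrot;
  elim/ind: y => [|a x1 x2|n|n j|k]; try exact: J0; try exact: JP; try exact: JC;
  rewrite Jrot;
  elim/ind: z => [|a x1 x2|l|l k|k]; try exact: J0; try exact: JP; try exact: JC.
- exact: JLLL.
- by rewrite Jrot; exact: JLLI.
- exact: JLLI.
- by rewrite Jrot; exact: JLII.
- by rewrite 2!Jrot; exact: JLLI.
- by rewrite 2!Jrot; exact: JLII.
- exact: JLII.
- exact: JIII.
Qed.

End GapRelations.

Section GapVirasoro.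
Variables (K : numFieldType) (p : nat).

Definition gapVir : Type := {malg K[gapgen p]}.
HB.instance Definition _ := GRing.Lmodule.on gapVir.

Definition gL (m : int) : gapVir := bvec K (GL p m).
Definition gI (m : int) (i : supidx p) : gapVir := bvec K (GI m i).
(* [gC k] is [C_k] for all [0 <= k <= p - 1], with [C_k = C_(p-k)] for [k > p/2]. *)
Definition gC (k : nat) : gapVir :=
  bvec K (GC p (inord (if (k <= p./2)%N then k else (p - k)%N))).

(* the degree [n + i / p] attached to [I_n^(i)] *)
Definition shift (n : int) (i : nat) : K := n%:~R + i%:R / p%:R.

Definition gen_bracket (x y : gapgen p) : gapVir :=
  match x, y with
  | GL m, GL n =>
      (m - n)%:~R *: gL (m + n)
      + ((m ^+ 3 - m)%:~R / 12%:R * (m + n == 0)%:R) *: gC 0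
  | GI m i, GI n j =>
      (shift m i * ((i + j == p)%N && (m + n + 1 == 0))%:R) *: gC i
  | GL m, GI n i => - shift n i *: gI (m + n) i
  | GI n i, GL m => shift n i *: gI (m + n) i
  | _, _ => 0
  end.

Definition gap_bracket : gapVir -> gapVir -> gapVir := linext2 gen_bracket.

Lemma gap_ind (P : gapVir -> Prop) :
  P 0 -> (forall a x y, P x -> P y -> P (a *: x + y)) ->
  (forall m, P (gL m)) -> (forall m i, P (gI m i)) -> (forall k, P (gC k)) ->
  forall x, P x.
Proof.
move=> P0 PD PL PI PC; apply: free_ind => // -[m|m i|j]; [exact: PL|exact: PI|].
have := PC j; rewrite /gC; have le_j : (j <= p./2)%N by rewrite -ltnS ltn_ord.
by rewrite le_j inord_val.
Qed.

Lemma gC_sym i j : (i + j)%N = p -> gC i = gC j.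
Proof.
move=> e; rewrite /gC; congr (bvec K (GC p (inord _))).
have e2 := odd_double_half p; rewrite -addnn in e2.
have o1 := leq_b1 (odd p).
by case: ifP; case: ifP; lia.
Qed.

Let linl y a x1 x2 :
  gap_bracket (a *: x1 + x2) y = a *: gap_bracket x1 y + gap_bracket x2 y.
Proof. exact: linext2_linearl. Qed.

Let linr x a y1 y2 :
  gap_bracket x (a *: y1 + y2) = a *: gap_bracket x y1 + gap_bracket x y2.
Proof. exact: linext2_linearr. Qed.

Lemma gap_bracketLL m n : gap_bracket (gL m) (gL n) =
  (m - n)%:~R *: gL (m + n)
  + ((m ^+ 3 - m)%:~R / 12%:R * (m + n == 0)%:R) *: gC 0.
Proof. exact: linext2U. Qed.

Lemma gap_bracketLI m n i :
  gap_bracket (gL m) (gI n i) = - shift n i *: gI (m + n) i.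
Proof. exact: linext2U. Qed.

Lemma gap_bracketIL m n i :
  gap_bracket (gI n i) (gL m) = shift n i *: gI (m + n) i.
Proof. exact: linext2U. Qed.

Lemma gap_bracketII m n i j : gap_bracket (gI m i) (gI n j) =
  (shift m i * ((i + j == p)%N && (m + n + 1 == 0))%:R) *: gC i.
Proof. exact: linext2U. Qed.

Lemma gap_bracketCr x k : gap_bracket x (gC k) = 0.
Proof.
elim/gap_ind: x => [|a x y hx hy|m|m i|j]; try by rewrite [LHS]linext2U.
- exact: linear0.
- by rewrite linl hx hy scaler0 addr0.
Qed.

Lemma gap_bracketCl k x : gap_bracket (gC k) x = 0.
Proof.
elim/gap_ind: x => [|a x y hx hy|m|m i|j]; try by rewrite [LHS]linext2U.
- by rewrite /gap_bracket /linext2 linextU linear0.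
- by rewrite linr hx hy scaler0 addr0.
Qed.

Fact gap_bracketxx x : gap_bracket x x = 0.
Proof.
exact: (br_alt gap_ind linl linr gap_bracketLL gap_bracketLI gap_bracketIL
  gap_bracketII gap_bracketCr gap_bracketCl gC_sym).
Qed.

Fact gap_jacobi x y z :
  gap_bracket x (gap_bracket y z) + gap_bracket y (gap_bracket z x)
  + gap_bracket z (gap_bracket x y) = 0.
Proof.
exact: (br_jacobi gap_ind linl linr gap_bracketLL gap_bracketLI gap_bracketIL
  gap_bracketII gap_bracketCr gap_bracketCl gC_sym).
Qed.

HB.instance Definition _ := Lmodule_isLie.Build K gapVir
  linl linr gap_bracketxx gap_jacobi.

End GapVirasoro.

Section GapModule.
Variables (K : numFieldType) (p : nat) (V : lmodType K).
Variable rho : gapgen p -> V -> V.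
Hypothesis rho_linear : forall a, linear (rho a).

Definition gap_act (x : gapVir K p) (v : V) : V := linext (rho^~ v) x.

Hypothesis rho_rel : forall a b v,
  gap_act (gen_bracket K a b) v = rho a (rho b v) - rho b (rho a v).

Fact gap_act_linearl v a x y :
  gap_act (a *: x + y) v = a *: gap_act x v + gap_act y v.
Proof. exact: linext_linear. Qed.

Let act0l v : gap_act 0 v = 0. Proof. exact: linear0. Qed.

Fact gap_act_linearr x a v w :
  gap_act x (a *: v + w) = a *: gap_act x v + gap_act x w.
Proof.
elim/free_ind: x => [|b x1 x2 h1 h2|k].
- by rewrite !act0l scaler0 addr0.
- rewrite !gap_act_linearl h1 h2.
  by rewrite !scalerDr !scalerA (mulrC b) addrACA.
- by rewrite /gap_act !linextU rho_linear.
Qed.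

Let act0r x : gap_act x 0 = 0.
Proof.
have := gap_act_linearr x (-1) 0 0.
by rewrite !scaleN1r oppr0 addr0 addNr.
Qed.

Let comb (a : K) (u v w z : V) :
  a *: (u - v) + (w - z) = a *: u + w - (a *: v + z).
Proof. by rewrite scalerBr opprD addrACA. Qed.

Fact gap_act_lie x y v :
  gap_act (lie x y) v = gap_act x (gap_act y v) - gap_act y (gap_act x v).
Proof.
rewrite /lie /=; elim/free_ind: x => [|a x1 x2 h1 h2|k].
- rewrite [gap_bracket 0 y](_ : _ = 0); last exact: linear0.
  by rewrite !act0l act0r subr0.
- rewrite [gap_bracket _ y]linext2_linearl !gap_act_linearl h1 h2.
  by rewrite gap_act_linearr comb.
elim/free_ind: y => [|a y1 y2 h1 h2|l].
- rewrite [gap_bracket _ 0](_ : _ = 0); last by rewrite /gap_bracket /linext2 linextU linear0.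
  by rewrite !act0l act0r subr0.
- rewrite [gap_bracket _ _]linext2_linearr !gap_act_linearl h1 h2.
  by rewrite gap_act_linearr comb.
rewrite [gap_bracket _ _]linext2U rho_rel.
by rewrite /gap_act !linextU.
Qed.

Definition gap_module : lieModule (gapVir K p) :=
  LieModule gap_act_linearl gap_act_linearr gap_act_lie.

Lemma gap_actL m v : act (gL K p m) (v : gap_module) = rho (GL p m) v.
Proof. exact: linextU. Qed.

Lemma gap_actI m i v : act (gI K m i) (v : gap_module) = rho (GI m i) v.
Proof. exact: linextU. Qed.

End GapModule.

Definition restricted (K : numFieldType) (p : nat)
    (M : lieModule (gapVir K p)) : Prop :=
  forall v : M, exists N : nat, forall n : nat, (N <= n)%N -> (1 <= n)%N ->
    act (gL K p n) v = 0 /\ forall i : supidx p, act (gI K n i) v = 0.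

Section Omega.
Variables (K : numFieldType) (p : nat) (lam : K) (lam_neq0 : lam != 0).
Variable alpha : p.-tuple K.

Let tr (c : K) (f : {poly K}) : {poly K} := f \Po ('X + c%:P).

Definition Omega_op (a : gapgen p) (f : {poly K}) : {poly K} :=
  match a with
  | GL n => lam ^ n *: (('X + (alpha`_0 * n%:~R)%:P) * (f \Po ('X + n%:~R%:P)))
  | GI n i => (alpha`_i * lam ^ n) *: (f \Po ('X + (n%:~R + i%:R / p%:R)%:P))
  | GC _ => 0
  end.

Let Omega_opL n f :
  Omega_op (GL p n) f = lam ^ n *: (('X + (alpha`_0 * n%:~R)%:P) * tr n%:~R f).
Proof. by []. Qed.

Let Omega_opI n i f :
  Omega_op (GI n i) f = (alpha`_i * lam ^ n) *: tr (shift K p n i) f.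
Proof. by []. Qed.

Let tr_tr c d f : tr c (tr d f) = tr (c + d) f.
Proof.
rewrite /tr -comp_polyA comp_polyD comp_polyX comp_polyC polyCD.
by rewrite addrA.
Qed.

Let trZ c b f : tr c (b *: f) = b *: tr c f.
Proof. exact: comp_polyZ. Qed.

Let trM c f g : tr c (f * g) = tr c f * tr c g.
Proof. exact: comp_polyM. Qed.

Let trX c d : tr c ('X + d%:P) = 'X + (c + d)%:P.
Proof. by rewrite /tr comp_polyD comp_polyX comp_polyC -addrA polyCD. Qed.

Fact Omega_op_linear a : linear (Omega_op a).
Proof.
case: a => [n|n i|j] b f g /=; last by rewrite scaler0 addr0.
  rewrite comp_polyD comp_polyZ mulrDr -scalerAr scalerDr !scalerA.
  by rewrite (mulrC b).
by rewrite comp_polyD comp_polyZ scalerDr !scalerA (mulrC b).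
Qed.

Let actE (c : K) a x v : gap_act Omega_op (c *: bvec K a + x) v
  = c *: Omega_op a v + gap_act Omega_op x v.
Proof. by rewrite gap_act_linearl [gap_act _ _ _]linextU. Qed.

Let act0 v : gap_act Omega_op 0 v = 0.
Proof. exact: linear0. Qed.

Let actZ (c : K) a v : gap_act Omega_op (c *: bvec K a) v = c *: Omega_op a v.
Proof. by rewrite -[c *: _]addr0 actE act0 addr0. Qed.

Let LI m n i f :
  Omega_op (GL p m) (Omega_op (GI n i) f) - Omega_op (GI n i) (Omega_op (GL p m) f)
  = - shift K p n i *: Omega_op (GI (m + n) i) f.
Proof.
rewrite !Omega_opL !Omega_opI !trZ trM !trX !tr_tr.
rewrite -!scalerAr !scalerA expfzDr //.
have -> : shift K p (m + n) i = m%:~R + shift K p n i.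
  by rewrite /shift intrD addrA.
rewrite (addrC (shift _ _ _ _) m%:~R) polyCD -!mul_polyC !polyCM.
by rewrite polyCN; ring.
Qed.

Fact Omega_op_rel a b f : gap_act Omega_op (gen_bracket K a b) f =
  Omega_op a (Omega_op b f) - Omega_op b (Omega_op a f).
Proof.
case: a => [m|m i|k]; case: b => [n|n j|l].
- rewrite actE actZ scaler0 addr0 !Omega_opL !trZ !trM !trX !tr_tr.
  rewrite -!scalerAr !scalerA expfzDr // !intrD intrN (addrC n%:~R m%:~R).
  rewrite -!mul_polyC !(polyCM, polyCD, polyCN).
  by ring.
- by rewrite actZ LI.
- by rewrite [LHS]act0 /= comp_poly0 mulr0 scaler0 subr0.
- by rewrite actZ -opprB LI -scaleNr opprK.
- rewrite actZ scaler0 !Omega_opI !trZ !tr_tr !scalerA.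
  apply/esym/eqP; rewrite subr_eq0 (addrC (shift _ _ n _)); apply/eqP.
  by congr (_ *: _); ring.
- by rewrite [LHS]act0 /= comp_poly0 scaler0 subr0.
- by rewrite [LHS]act0 /= comp_poly0 mulr0 scaler0 subr0.
- by rewrite [LHS]act0 /= comp_poly0 scaler0 subr0.
- by rewrite [LHS]act0 /= subr0.
Qed.

Definition Omega : lieModule (gapVir K p) := gap_module Omega_op_linear Omega_op_rel.

End Omega.

Section TOmega.
Variables (K : numFieldType) (p : nat) (lam : K) (lam_neq0 : lam != 0).

Let Om := Omega lam_neq0 (nseq_tuple p 0).

Definition tpoly : set Om := [set f | exists g : {poly K}, f = 'X * g].

Fact tpoly_submodule : is_submodule tpoly.
Proof.
have T0 : tpoly 0 by exists 0; rewrite mulr0.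
have TD a v w : tpoly v -> tpoly w -> tpoly (a *: v + w).
  move=> [f ->] [g ->]; exists (a *: f + g).
  by rewrite mulrDr scalerAr.
split=> // x v Tv; elim/gap_ind: x => [|a x y hx hy|m|m i|k].
- by rewrite [act _ _](_ : _ = 0) //; exact: linear0.
- by rewrite act_linearl; apply: TD.
- rewrite [act _ _]gap_actL /= nth_nseq if_same mul0r addr0.
  by exists (lam ^ m *: (v \Po ('X + m%:~R%:P))); rewrite scalerAr.
- by rewrite [act _ _]gap_actI /= nth_nseq if_same mul0r scale0r.
- by rewrite [act _ _]linextU.
Qed.

Definition tOmega : lieModule (gapVir K p) := submodule tpoly_submodule.

End TOmega.

(* Main.v *)
Require Import Defs.
From mathcomp Require Import all_boot all_order all_algebra.
From mathcomp Require Import boolp classical_sets reals complex.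
From mathcomp Require Import ring.

(** Let [W] be a nonzero submodule of [A (x) M], where [A] is either polynomial
    module and [e_0, e_1, ...] is its basis of monomials.  A nonzero element of [W] is
    [w = sum_(j <= d) e_j (x) v_j] with [v_d != 0].  Since [M] is restricted,
    [L_n] and [I_n^(i)] kill all the [v_j] once [n] is large, and then act on
    the left factors only.  There they act by [lam ^ n] times an expression that
    is polynomial in [n], so [W] contains all large values of a polynomial in
    [n] with coefficients in [A (x) M]; the Vandermonde determinant shows that
    it contains each coefficient ([coef_mem_submodule]).

    Two coefficients are enough.
    - The constant term of the action of [L_n] is multiplication by [t], which
      sends [e_j (x) v] to [e_(j+1) (x) v].
    - The top coefficient isolates [e_0 (x) v_d], because the action on [e_j]
      has degree in [n] growing strictly with [j].  For [Omega] one picks [i]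
      with [alpha_i != 0] and uses [(t + alpha_0 n) (t + n) ^ j] if [i = 0],
      [alpha_i (t + n + i / p) ^ j] if [i > 0]; for [t Omega(lam, 0)] one uses
      [t (t + n) ^ (j + 1)].

    Hence [W] contains [A (x) v_d].  The vectors [v] with [A (x) v] inside [W]
    form a submodule of [M], which is nonzero and therefore all of [M], so
    [W] is everything ([tensor_irreducible]). *)

Set Implicit Arguments.
Unset Strict Implicit.
Unset Printing Implicit Defensive.

Import GRing.Theory Num.Theory.
Local Open Scope ring_scope.
Local Open Scope complex_scope.

(** * Linear maps given as plain functions *)

(** The actions and [fun v => tens v w] are bare functions with a linearity
    equation, so the consequences of linearity are stated for such functions. *)
Lemma linear_op0 (K : fieldType) (U V : lmodType K) (h : U -> V) :
  linear h -> h 0 = 0.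
Proof. by move=> /(_ (-1) 0 0); rewrite !scaleN1r oppr0 addr0 addNr. Qed.

Lemma linear_op_comb (K : fieldType) (U V : lmodType K) (h : U -> V) n
    (a : nat -> K) (x : nat -> U) :
  linear h -> h (\sum_(i < n) a i *: x i) = \sum_(i < n) a i *: h (x i).
Proof.
move=> hl; elim: n => [|n IHn]; first by rewrite !big_ord0 linear_op0.
by rewrite !big_ord_recr /= addrC hl IHn addrC.
Qed.

Lemma linear_op_sum (K : fieldType) (U V : lmodType K) (h : U -> V) n
    (x : nat -> U) :
  linear h -> h (\sum_(i < n) x i) = \sum_(i < n) h (x i).
Proof.
move=> hl; have := @linear_op_comb _ _ _ h n (fun=> 1) x hl.
by under eq_bigr do rewrite scale1r; under [RHS]eq_bigr do rewrite scale1r.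
Qed.

Lemma linear_opZ (K : fieldType) (U V : lmodType K) (h : U -> V) a x :
  linear h -> h (a *: x) = a *: h x.
Proof. by move=> hl; rewrite -[a *: x]addr0 hl linear_op0 // addr0. Qed.

(** * Coefficients of vector-valued polynomials *)

Section Subspace.
Variables (K : numFieldType) (V : lmodType K) (S : V -> Prop).
Hypothesis S0 : S 0.
Hypothesis SD : forall a v w, S v -> S w -> S (a *: v + w).

Lemma subspace_scale a v : S v -> S (a *: v).
Proof. by move=> Sv; rewrite -[_ *: _]addr0; apply: SD. Qed.

Lemma subspace_comb n (a : 'I_n -> K) (v : 'I_n -> V) :
  (forall i, S (v i)) -> S (\sum_(i < n) a i *: v i).
Proof.
by move=> Sv; elim/big_rec: _ => [//|i x _ Sx]; apply: SD.
Qed.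

(** Evaluating at the [m] points [N, ..., N + m - 1] gives a linear system with
    invertible Vandermonde matrix, in characteristic zero; its inverse expresses
    each coefficient as a combination of the values. *)
Lemma polynomial_coef_mem m (c : nat -> V) N :
  (forall n, (N <= n)%N -> S (\sum_(k < m) n%:R ^+ k *: c k)) ->
  forall k, (k < m)%N -> S (c k).
Proof.
move=> Sc k lt_km.
pose a := \row_(j < m) (N + j)%:R : 'rV[K]_m.
have Vunit : Vandermonde m a \in unitmx.
  rewrite unitmxE det_Vandermonde unitfE.
  apply/prodf_neq0 => i _; apply/prodf_neq0 => j lt_ij.
  by rewrite !mxE subr_eq0 eqr_nat eqn_add2l gtn_eqF.
pose B := invmx (Vandermonde m a).
suff -> : c k = \sum_(j < m) B j (Ordinal lt_km) *:
    (\sum_(l < m) (N + j)%:R ^+ l *: c l).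
  by apply: subspace_comb => j; apply: Sc; apply: leq_addr.
under eq_bigr => j _ do rewrite scaler_sumr.
rewrite exchange_big /=.
transitivity (\sum_(l < m) (Vandermonde m a *m B) l (Ordinal lt_km) *: c l).
  rewrite mulmxV // (bigD1 (Ordinal lt_km)) //= mxE eqxx scale1r.
  by rewrite big1 ?addr0 // => l nl; rewrite mxE (negPf nl) scale0r.
apply: eq_bigr => l _; rewrite mxE scaler_suml.
by apply: eq_bigr => j _; rewrite !mxE scalerA mulrC.
Qed.

End Subspace.

(** * An irreducibility criterion for tensor products *)

Section TensorCriterion.
Variables (K : numFieldType) (g : lieAlgType K) (A M : lieModule g).

Let tensl (w : M) : linear (fun v : A => tens v w).
Proof. by move=> a v1 v2; apply: tens_linearl. Qed.

Let tensr (v : A) : linear (fun w : M => tens v w).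
Proof. by move=> a w1 w2; apply: tens_linearr. Qed.

(** A family [x n] that eventually annihilates each vector of [M] acts, for large
    [n], on the left tensor factors alone.  When that left action is polynomial
    in [n] up to a nonzero factor [mu n], each of its coefficients therefore
    preserves [W], although it need not come from the Lie algebra. *)
Lemma coef_mem_submodule (x : nat -> g) (mu : nat -> K) (W : set (tensor_module A M))
    (d m : nat) (f : nat -> A) (v : nat -> M) (c : nat -> nat -> A) :
  (forall w : M, exists N, forall n, (N <= n)%N -> act (x n) w = 0) ->
  (forall n, mu n != 0) ->
  (forall n j, (j < d)%N ->
     act (x n) (f j) = mu n *: \sum_(k < m) n%:R ^+ k *: c j k) ->
  is_submodule W ->
  W (\sum_(j < d) tens (f j) (v j)) ->
  forall k, (k < m)%N -> W (\sum_(j < d) tens (c j k) (v j)).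
Proof.
move=> x_tail mu_neq0 xf [W0 WD WA] Ww.
have [N vanish] : exists N, forall n j, (N <= n)%N -> (j < d)%N ->
    act (x n) (v j) = 0.
  elim: d {xf Ww} => [|d [N IH]]; first by exists 0%N.
  have [N' H] := x_tail (v d); exists (maxn N N') => n j.
  rewrite geq_max (ltnS j) (leq_eqVlt j) => /andP [leNn leN1n] /orP [/eqP->|lt_jd].
    exact: H.
  exact: IH.
apply: (polynomial_coef_mem W0 WD (N := N)) => n leNn.
have -> : \sum_(k < m) n%:R ^+ k *: (\sum_(j < d) tens (c j k) (v j)) =
    (mu n)^-1 *: tens_act (x n) (\sum_(j < d) tens (f j) (v j)).
  have tl : linear (tens_act (x n) : tensor A M -> tensor A M).
    by move=> a y z; apply: tens_act_linearr.
  rewrite (linear_op_sum _ (fun j => tens (f j) (v j)) tl) scaler_sumr.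
  under eq_bigr => k _ do rewrite scaler_sumr.
  rewrite exchange_big /=; apply: eq_bigr => j _.
  have tr0 : tens (f j) (0 : M) = 0 by apply: linear_op0 (tensr (f j)).
  rewrite tens_actE vanish // tr0 addr0 xf //.
  rewrite (linear_opZ _ _ (tensl _)) scalerA mulVf // scale1r.
  by rewrite (linear_op_comb _ (fun k => n%:R ^+ k) (c j) (tensl _)).
by apply: (subspace_scale W0 WD); apply: WA Ww.
Qed.

Variable e : nat -> A.
Hypothesis e_span : forall f, exists d (a : nat -> K), f = \sum_(j < d) a j *: e j.

(** The vanishing of [v] beyond [d] lets expansions of different lengths be
    padded to a common length and added. *)
Lemma tensor_basis_expansion (w : tensor A M) :
  exists d (v : nat -> M), (forall j, (d <= j)%N -> v j = 0) /\
    w = \sum_(j < d) tens (e j) (v j).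
Proof.
have pad d D (v : nat -> M) : (forall j, (d <= j)%N -> v j = 0) -> (d <= D)%N ->
    \sum_(j < d) tens (e j) (v j) = \sum_(j < D) tens (e j) (v j).
  move=> v0 le_dD; rewrite (big_ord_widen _ (fun j => tens (e j) (v j)) le_dD).
  rewrite big_mkcond; apply: eq_bigr => j _; case: ltnP => // le_dj.
  by rewrite v0 //; apply/esym; apply: linear_op0 (tensr (e j)).
elim/tensor_ind: w => [|a x y [dx [vx [zx ->]]] [dy [vy [zy ->]]]|f w].
- by exists 0%N, (fun=> 0); rewrite big_ord0.
- exists (maxn dx dy), (fun j => a *: vx j + vy j); split=> [j|].
    by rewrite geq_max => /andP [lx ly]; rewrite zx // zy // scaler0 addr0.
  rewrite (pad _ _ vx zx (leq_maxl dx dy)) (pad _ _ vy zy (leq_maxr dx dy)).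
  rewrite scaler_sumr -big_split /=; apply: eq_bigr => j _.
  by rewrite tens_linearr.
- have [d [a ->]] := e_span f.
  exists d, (fun j => if (j < d)%N then a j *: w else 0); split=> [j le_dj|].
    by rewrite ltnNge le_dj.
  rewrite (linear_op_comb _ a e (tensl w)); apply: eq_bigr => j _.
  by rewrite ltn_ord (linear_opZ _ _ (tensr _)).
Qed.

Lemma tensor_top_term (w : tensor A M) : w != 0 ->
  exists d (v : nat -> M), v d != 0 /\ w = \sum_(j < d.+1) tens (e j) (v j).
Proof.
have [d [v [_ ->]]] := tensor_basis_expansion w.
elim: d => [|d IHd]; first by rewrite big_ord0 eqxx.
have [v0|v_neq0] := eqVneq (v d) 0; last by exists d, v.
rewrite big_ord_recr /= v0.
have -> : tens (e d) (0 : M) = 0 by apply: linear_op0 (tensr (e d)).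
by rewrite addr0.
Qed.

(** The form [phi] shows that [e 0 (x) v] is nonzero for [v != 0], through the
    map [f (x) v |-> phi f *: v].  For a nonzero [W], [lower] and then [raise]
    put some [A (x) v] with [v != 0] inside [W], and the set [N] of all such [v]
    is a submodule of the irreducible [M]. *)
Lemma tensor_irreducible (phi : A -> K) :
  (forall a f1 f2, phi (a *: f1 + f2) = a * phi f1 + phi f2) ->
  phi (e 0) != 0 ->
  irreducible M ->
  (forall W : set (tensor_module A M), is_submodule W ->
     forall j v, W (tens (e j) v) -> W (tens (e j.+1) v)) ->
  (forall W : set (tensor_module A M), is_submodule W ->
     forall d (v : nat -> M), W (\sum_(j < d.+1) tens (e j) (v j)) ->
       W (tens (e 0) (v d))) ->
  irreducible (tensor_module A M).
Proof.
move=> phi_lin phi_e0 [[v0 v0_neq0] M_simple] raise lower; split.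
  exists (tens (e 0) v0); apply/eqP => e0v0.
  have fl (w : M) a (f1 f2 : A) : phi (a *: f1 + f2) *: w =
      a *: (phi f1 *: w) + phi f2 *: w by rewrite phi_lin scalerDl scalerA.
  have fr (f : A) a (w1 w2 : M) : phi f *: (a *: w1 + w2) =
      a *: (phi f *: w1) + phi f *: w2 by rewrite scalerDr !scalerA mulrC.
  have := tlift_tens fl fr (e 0) v0; rewrite e0v0.
  rewrite (linear_op0 (tlift_linear fl fr)) => /esym/eqP.
  by rewrite scaler_eq0 (negPf phi_e0) (negPf v0_neq0).
move=> W Wsub; have [W0 WD WA] := Wsub.
have [[w [Ww w_neq0]]|Wtriv] := pselect (exists w, W w /\ w != 0); last first.
  left; apply/seteqP; split=> w /=; last by move->.
  by move=> Ww; apply/eqP/negP => /negP w_neq0; apply: Wtriv; exists w.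
right.
pose N : set M := fun v => forall f : A, W (tens f v).
have Nsub : is_submodule N.
  split=> [f|a v1 v2 N1 N2 f|x v Nv f] /=.
  - by have -> : tens f (0 : M) = 0 by apply: linear_op0 (tensr f).
  - by rewrite tens_linearr; apply: WD.
  (* The product rule: [f (x) x v = x (f (x) v) - (x f) (x) v]. *)
  - have -> : tens f (act x v) =
        (-1) *: tens (act x f) v + tens_act x (tens f v).
      by rewrite tens_actE scaleN1r addKr.
    by apply: WD => //; apply: WA.
have [d [v [vd_neq0 w_eq]]] := tensor_top_term w_neq0.
have Nvd : N (v d).
  have We j : W (tens (e j) (v d)).
    elim: j => [|j IHj]; last exact: raise.
    by apply: (lower W Wsub d v); rewrite -w_eq.
  move=> f; have [m [a ->]] := e_span f.
  rewrite (linear_op_comb _ a e (tensl _)).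
  exact: (subspace_comb W0 WD (fun i => a i) (fun i => We i)).
have NT : N = setT.
  case: (M_simple N Nsub) => // N0; move: Nvd vd_neq0.
  by rewrite N0 => ->; rewrite eqxx.
apply/seteqP; split=> // y _; elim/tensor_ind: y => [//|a y z|f v'].
  exact: WD.
by have : N v' by rewrite NT.
Qed.

End TensorCriterion.

(** * The polynomial modules *)

Lemma restricted_tail_vanishes (K : numFieldType) (p : nat)
    (M : lieModule (gapVir K p)) : restricted M ->
  forall w : M, exists N, forall n, (N <= n)%N ->
    act (gL K p n) w = 0 /\ forall i : supidx p, act (gI K n i) w = 0.
Proof.
move=> M_res w; have [N H] := M_res w; exists (maxn N 1) => n.
by rewrite geq_max => /andP [leNn lt0n]; apply: H.
Qed.

(** The binomial formula, with the sum padded up to a bound [d] common to all the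
    exponents [j] that occur in one tensor. *)
Lemma shifted_power_expansion (K : fieldType) (y : {poly K}) (c : K) (d j : nat) :
  (j <= d)%N ->
  (y + c%:P) ^+ j = \sum_(k < d.+1) c ^+ k *: ('C(j, k)%:R *: y ^+ (j - k)).
Proof.
move=> le_jd; rewrite exprDn.
rewrite (big_ord_widen _ (fun k => y ^+ (j - k) * c%:P ^+ k *+ 'C(j, k))
  (le_jd : (j.+1 <= d.+1)%N)) big_mkcond.
apply: eq_bigr => k _; rewrite -polyC_exp mulrC mul_polyC -scaler_nat.
case: ltnP => [_|lt_jk]; first by rewrite !scalerA mulrC.
by rewrite bin_small // scale0r scaler0.
Qed.

Lemma sum_top_delta (K : fieldType) (A M : lmodType K) (a : A) (c : nat -> A)
    (d : nat) (v : nat -> M) :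
  (forall j, (j < d)%N -> c j = 0) -> c d = a ->
  \sum_(j < d.+1) tens (c j) (v j) = tens a (v d).
Proof.
move=> c0 <-; rewrite big_ord_recr /= big1 ?add0r // => j _.
rewrite c0 //; apply: (@linear_op0 _ _ _ (fun f => tens f (v j))) => b f1 f2.
exact: tens_linearl.
Qed.

Section OmegaTensor.
Variables (K : numFieldType) (p : nat) (lam : K) (lam_neq0 : lam != 0).
Variables (alpha : p.-tuple K) (M : lieModule (gapVir K p)).
Hypothesis M_res : restricted M.

Notation Om := (Omega lam_neq0 alpha).

Let e (j : nat) : Om := ('X^j : {poly K}).

Let L_tail (w : M) : exists N, forall n : nat, (N <= n)%N -> act (gL K p n) w = 0.
Proof.
have [N H] := restricted_tail_vanishes M_res w.
by exists N => n /H [].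
Qed.

Let I_tail (i : supidx p) (w : M) :
  exists N, forall n : nat, (N <= n)%N -> act (gI K n i) w = 0.
Proof.
have [N H] := restricted_tail_vanishes M_res w.
by exists N => n /H [_].
Qed.

(** The coefficient of [n ^ k] in [(t + alpha_0 n) (t + n) ^ j]: the first summand
    comes from [t], the second from [alpha_0 n]. *)
Let cL (j k : nat) : Om :=
  ('C(j, k)%:R *: 'X^(j.+1 - k) +
  (if k is k'.+1 then (alpha`_0 * 'C(j, k')%:R) *: 'X^(j - k') else 0) : {poly K}).

Let act_L_power (d n j : nat) : (j < d.+1)%N ->
  act (gL K p n) (e j) = lam ^ n *: \sum_(k < d.+2) n%:R ^+ k *: cL j k.
Proof.
rewrite ltnS => le_jd; rewrite gap_actL /=; congr (_ *: _).
rewrite comp_Xn_poly mulrDl -pmulrn.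
under [RHS]eq_bigr => k _ do rewrite scalerDr.
rewrite big_split /=; congr (_ + _).
  rewrite big_ord_recr /= (@bin_small j d.+1) // scale0r scaler0 addr0.
  rewrite (shifted_power_expansion _ _ le_jd) mulr_sumr.
  apply: eq_bigr => k _; rewrite -!scalerAr -exprS.
  have [le_kj|lt_jk] := leqP k j; first by rewrite subSn.
  by rewrite bin_small // !scale0r.
rewrite big_ord_recl /= scaler0 add0r (shifted_power_expansion _ _ le_jd).
rewrite mulr_sumr; apply: eq_bigr => k _.
by rewrite mul_polyC !scalerA exprS; congr (_ *: _); ring.
Qed.

(** The coefficient of [n ^ k] in [(t + i / p + n) ^ j]. *)
Let cI (i : supidx p) (j k : nat) : Om :=
  ('C(j, k)%:R *: ('X + (i%:R / p%:R)%:P) ^+ (j - k) : {poly K}).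

Let act_I_power (i : supidx p) (d n j : nat) : (j < d.+1)%N ->
  act (gI K n i) (e j) =
    (alpha`_i * lam ^ n) *: \sum_(k < d.+1) n%:R ^+ k *: cI i j k.
Proof.
rewrite ltnS => le_jd; rewrite gap_actI /=; congr (_ *: _).
rewrite comp_Xn_poly addrC -pmulrn polyCD addrC (addrC _ (_ / _)%:P) addrA.
exact: shifted_power_expansion.
Qed.

Lemma Omega_tensor_irreducible :
  irreducible M -> alpha != nseq_tuple p 0 -> irreducible (tensor_module Om M).
Proof.
move=> M_irr alpha_neq0.
have lam_pow_neq0 (n : nat) : lam ^ n != 0 by rewrite expfz_neq0.
apply: (@tensor_irreducible _ _ Om M e _ (fun f : {poly K} => f`_0)) => //.
- move=> f; exists (size (f : {poly K})), (fun j => (f : {poly K})`_j).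
  by rewrite -[LHS]coefK poly_def.
- by move=> a f1 f2; rewrite coefD coefZ.
- by rewrite coefXn oner_neq0.
- move=> W Wsub j v Wjv.
  (* A single tensor; the coefficient of [n ^ 0] is multiplication by [t]. *)
  have act_L (n l : nat) : (l < 1)%N -> act (gL K p n) (e j) =
      lam ^ n *: \sum_(k < j.+2) n%:R ^+ k *: cL j k.
    by move=> _; apply: act_L_power (ltnSn j).
  have := coef_mem_submodule (d := 1) (f := fun=> e j) (v := fun=> v)
    (c := fun _ k => cL j k) L_tail lam_pow_neq0 act_L Wsub.
  rewrite big_ord1 => /(_ Wjv 0%N isT).
  by rewrite big_ord1 /cL bin0 scale1r addr0 subn0.
- move=> W Wsub d v Wdv.
  have /existsP [i alpha_i] : [exists i : 'I_p, alpha`_i != 0].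
    apply: contraNT alpha_neq0 => /existsPn alpha0; apply/eqP/eq_from_tnth => i.
    by rewrite !(tnth_nth 0) nth_nseq ltn_ord; apply/eqP/negPn/alpha0.
  have [i0|i_gt0] := posnP i.
    (* [n ^ (d + 1)] arises only from [alpha_0 n] times the top of [(t + n) ^ d]. *)
    rewrite i0 in alpha_i.
    have := coef_mem_submodule (c := cL) L_tail lam_pow_neq0 (@act_L_power d)
      Wsub Wdv (ltnSn d.+1).
    rewrite (sum_top_delta (a := alpha`_0 *: e 0) (c := fun j => cL j d.+1))
      => [|j lt_jd|].
    + have tl : linear (fun f : Om => tens f (v d)).
        by move=> b f1 f2; apply: tens_linearl.
      rewrite (linear_opZ _ _ tl) => Wd; have [W0 WD _] := Wsub.
      by rewrite -[tens _ _](scalerK alpha_i); apply: (subspace_scale W0 WD).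
    + by rewrite /cL !bin_small ?mulr0 ?scale0r ?addr0 // ltnS ltnW.
    + by rewrite /cL bin_small // scale0r add0r binn mulr1 subnn.
  pose s : supidx p := Sub i i_gt0.
  have mu_neq0 (n : nat) : alpha`_s * lam ^ n != 0 by rewrite mulf_neq0.
  have := coef_mem_submodule (c := cI s) (I_tail s) mu_neq0 (@act_I_power s d)
    Wsub Wdv (ltnSn d).
  rewrite (sum_top_delta (a := e 0) (c := fun j => cI s j d)) // => [j lt_jd|].
    by rewrite /cI bin_small // scale0r.
  by rewrite /cI binn subnn expr0 scale1r.
Qed.

End OmegaTensor.

Section TOmegaTensor.
Variables (K : numFieldType) (p : nat) (lam : K) (lam_neq0 : lam != 0).
Variable M : lieModule (gapVir K p).
Hypothesis M_res : restricted M.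

Notation tOm := (tOmega p lam_neq0).

Fact tXn_mem (j : nat) :
  ('X^(j.+1) : {poly K}) \in subm_pred (tpoly_submodule p lam_neq0).
Proof. by apply/asboolP; exists ('X^j : {poly K}); rewrite exprS. Qed.

Let e (j : nat) : tOm := Sub ('X^(j.+1) : {poly K}) (tXn_mem j).

(** The coefficient of [n ^ k] in [t (t + n) ^ (j + 1)]. *)
Let c (j k : nat) : tOm := 'C(j.+1, k)%:R *: e (j.+1 - k).

(** Identities in the submodule are checked on the underlying polynomials. *)
Let val_comb n (a : nat -> K) (x : nat -> tOm) :
  val (\sum_(k < n) a k *: x k) = \sum_(k < n) a k *: (val (x k) : {poly K}).
Proof. exact: (linear_op_comb n a x (fun b u v => erefl)). Qed.

Let act_L_basis (d n j : nat) : (j < d.+1)%N ->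
  act (gL K p n) (e j) = lam ^ n *: \sum_(k < d.+2) n%:R ^+ k *: c j k.
Proof.
rewrite ltnS => le_jd; apply: val_inj.
transitivity (lam ^ n *: val (\sum_(k < d.+2) n%:R ^+ k *: c j k) : {poly K}) => //.
rewrite val_comb [LHS]gap_actL /=; congr (_ *: _).
rewrite nth_nseq if_same mul0r addr0 comp_Xn_poly -pmulrn.
rewrite (shifted_power_expansion _ _ (le_jd : (j.+1 <= d.+1)%N)) mulr_sumr.
apply: eq_bigr => k _; rewrite -!scalerAr -exprS; congr (_ *: _).
Qed.

Lemma tOmega_tensor_irreducible :
  irreducible M -> irreducible (tensor_module tOm M).
Proof.
move=> M_irr.
have lam_pow_neq0 (n : nat) : lam ^ n != 0 by rewrite expfz_neq0.
have L_tail w : exists N, forall n : nat, (N <= n)%N -> act (gL K p n) (w : M) = 0.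
  by have [N H] := restricted_tail_vanishes M_res w; exists N => n /H [].
apply: (@tensor_irreducible _ _ tOm M e _ (fun f => (val f : {poly K})`_1)) => //.
- move=> f; have [h fE] : exists h : {poly K}, val f = 'X * h.
    by apply/asboolP; exact: (valP f).
  exists (size h), (fun j => h`_j); apply: val_inj.
  rewrite val_comb fE -[h in LHS]coefK poly_def mulr_sumr.
  by apply: eq_bigr => j _; rewrite -scalerAr -exprS.
- by move=> a f1 f2; rewrite -coefZ -coefD.
- by rewrite /= coefXn oner_neq0.
- move=> W Wsub j v Wjv.
  (* A single tensor; the coefficient of [n ^ 0] is multiplication by [t]. *)
  have act_L (n l : nat) : (l < 1)%N -> act (gL K p n) (e j) =
      lam ^ n *: \sum_(k < j.+2) n%:R ^+ k *: c j k.
    by move=> _; apply: act_L_basis (ltnSn j).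
  have := coef_mem_submodule (d := 1) (f := fun=> e j) (v := fun=> v)
    (c := fun _ k => c j k) L_tail lam_pow_neq0 act_L Wsub.
  rewrite big_ord1 => /(_ Wjv 0%N isT).
  by rewrite big_ord1 /c bin0 scale1r subn0.
- move=> W Wsub d v Wdv.
  have := coef_mem_submodule (c := c) L_tail lam_pow_neq0 (@act_L_basis d)
    Wsub Wdv (ltnSn d.+1).
  rewrite (sum_top_delta (a := e 0) (c := fun j => c j d.+1)) // => [j lt_jd|].
    by rewrite /c bin_small // scale0r.
  by rewrite /c binn subnn scale1r.
Qed.

End TOmegaTensor.

Theorem proposition5p1 (R : realType) (p : nat) (p_gt1 : (1 < p)%N)
    (lam : R[i]) (lam_neq0 : lam != 0) (alpha : p.-tuple R[i])
    (M : lieModule (gapVir R[i] p))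
    (M_irr : irreducible M) (M_res : restricted M) :
  (alpha != nseq_tuple p 0 ->
     irreducible (tensor_module (Omega lam_neq0 alpha) M)) /\
  irreducible (tensor_module (tOmega p lam_neq0) M).
Proof.
split; first exact: Omega_tensor_irreducible.
exact: tOmega_tensor_irreducible.
Qed.
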